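(* Let $q>2$ be a prime power and let $C$ be an $[n,k,d]_{q^2}$ linear code such that $C^{\perp h}\subseteq C$ and $\dim(C)-\dim(C^{\perp h})=\ell$. Then for each integer $c$ with $0\le c\le\ell$ there exists an $[[n+c,\,2k-n,\,d';\,c]]_q$ EAQECC with $d\le d'\le d+c$.
   Context: An $[n,k,d]_{q^2}$ linear code is a $k$-dimensional subspace of $\mathbb{F}_{q^2}^n$ with minimum Hamming distance $d$. The Hermitian dual is $C^{\perp h}=\{v\in\mathbb{F}_{q^2}^n : \sum_i v_i w_i^q=0\ \forall w\in C\}$. An $[[n,k,d;c]]_q$ entanglement-assisted quantum error-correcting code (EAQECC) encodes $k$ logical qudits into $n$ physical qudits using $c$ copies of maximally entangled states pre-shared between sender and receiver. In standard terms: with $\mathcal{H}=\mathbb{C}^q$ and $\Phi=q^{-1/2}\sum_{i}|i\rangle|i\rangle\in\mathcal{H}\otimes\mathcal{H}$, it is a subspace $Q=\{(U\otimes I)(|\psi\rangle\otimes|0\rangle^{\otimes (n-k-c)}\otimes\Phi^{\otimes c}):\psi\in\mathcal{H}^{\otimes k}\}$ of $\mathcal{H}^{\otimes n}\otimes\mathcal{H}^{\otimes c}$, where $U$ is a unitary on the sender's $n$ qudits (the $k$ data qudits, the $n-k-c$ ancillas and the sender's halves of the $c$ pairs) and $I$ acts on the receiver's $c$ halves, such that, with $P$ the orthogonal projector onto $Q$, for every operator $E$ on $\mathcal{H}^{\otimes n}$ acting nontrivially on at most $d-1$ qudits there is a scalar $\lambda_E$ with $P(E\otimes I)P=\lambda_E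 P$. *)

(* Defs.v *)
From HB Require Import structures.
From mathcomp Require Import all_boot all_order all_algebra.
From mathcomp Require Import spectral complex.
From mathcomp Require Import reals.

Set Implicit Arguments.
Unset Strict Implicit.
Unset Printing Implicit Defensive.

Import Order.TTheory GRing.Theory Num.Theory.
Local Open Scope ring_scope.
Local Open Scope sesquilinear_scope.

Section LinearCodes.
Variables (F : finFieldType) (n : nat).
Implicit Types (u v w : 'rV[F]_n) (C : {vspace 'rV[F]_n}).

Definition hamming_dist u v : nat := #|[set i | u 0 i != v 0 i]|.

Definition min_dist C (d : nat) : Prop :=
  (exists u v, [/\ u \in C, v \in C, u != v & hamming_dist u v = d]) /\
  (forall u v, u \in C -> v \in C -> u != v -> (d <= hamming_dist u v)%N).

(* [n, k, d] code; the length n is carried by the ambient space 'rV[F]_n. *)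
Definition linear_code C (k d : nat) : Prop := \dim C = k /\ min_dist C d.

Definition herm_form (q : nat) w v : F^o := \sum_i v 0 i * w 0 i ^+ q.

Fact herm_form_linear q w : linear (herm_form q w).
Proof.
move=> a u v; rewrite /herm_form scaler_sumr -big_split /=.
by apply: eq_bigr => i _; rewrite !mxE mulrDl -mulrA.
Qed.

HB.instance Definition _ q w :=
  GRing.isLinear.Build F 'rV[F]_n F^o _ (herm_form q w) (herm_form_linear q w).

(* The intersection, over the codewords w, of the kernels of herm_form q w;
   see herm_dualP. *)
Definition herm_dual (q : nat) C : {vspace 'rV[F]_n} :=
  (\bigcap_(w in C) lker (linfun (herm_form q w)))%VS.

Lemma herm_dualP q C v :
  reflect (forall w, w \in C -> \sum_i v 0 i * w 0 i ^+ q = 0)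
          (v \in herm_dual q C).
Proof.
rewrite memvE; apply: (iffP subv_bigcapP) => [vC w /vC|vC w /vC vw0].
  by rewrite -memvE memv_ker lfunE => /eqP.
by rewrite -memvE memv_ker lfunE; apply/eqP.
Qed.

End LinearCodes.

(* For a finite type T, the vectors 'cV[C]_#|T| and the operators 'M[C]_#|T|
   are those of the Hilbert space with orthonormal basis T; coordinates are
   accessed through the enumeration of T. *)
Section FiniteHilbertSpaces.
Variable C : numClosedFieldType.

Definition amp (T : finType) (v : 'cV[C]_#|T|) (x : T) : C :=
  v (enum_rank x) 0.
Definition ket (T : finType) (f : T -> C) : 'cV[C]_#|T| :=
  \col_i f (enum_val i).
Definition entry (T : finType) (A : 'M[C]_#|T|) (x y : T) : C :=
  A (enum_rank x) (enum_rank y).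

Definition tens_op (T1 T2 : finType) (A : 'M[C]_#|T1|) (B : 'M[C]_#|T2|) :
    'M[C]_#|{: T1 * T2}| :=
  \matrix_(i, j) (entry A (enum_val i).1 (enum_val j).1 *
                  entry B (enum_val i).2 (enum_val j).2).

Definition orth_projector (N : nat) (P : 'M[C]_N) (Q : {vspace 'cV[C]_N}) :
    Prop :=
  [/\ P *m P = P, P^t* = P & forall v, v \in Q <-> exists w, v = P *m w].

End FiniteHilbertSpaces.

Section Qudits.
Variables (C : numClosedFieldType) (q : nat).

(* Computational basis of the tensor product of copies of C^q labelled by I. *)
Definition qbasis (I : finType) : finType := {ffun I -> 'I_q}.

Definition qrestr (I : finType) (S : {set I}) (x : qbasis I) :
    qbasis {i : I | i \in S} := [ffun i => x (val i)].

(* E acts as A on the qudits in S and as the identity on the others. *)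
Definition supported_on (I : finType) (S : {set I}) (E : 'M[C]_#|qbasis I|) :
    Prop :=
  exists A : 'M[C]_#|qbasis {i : I | i \in S}|, forall x y : qbasis I,
    entry E x y = entry A (qrestr S x) (qrestr S y) *
                  \prod_(i | i \notin S) (x i == y i)%:R.

(* Amplitudes of |0> in C^q, and of the maximally entangled state Phi. *)
Definition ket0_amp (a : 'I_q) : C := ((a : nat) == 0%N)%:R.
Definition phi_amp (a b : 'I_q) : C := (sqrtC q%:R)^-1 * (a == b)%:R.

(* The sender's n qudits, labelled by their role before encoding: k data
   qudits, n - k - c ancillas and c halves of entangled pairs.  It has exactly
   n elements only when k + c <= n, which is_eaqecc requires. *)
Definition sender (n k c : nat) : finType :=
  ('I_k + 'I_(n - k - c) + 'I_c)%type.

(* psi (x) |0>^(n-k-c) (x) Phi^c, in the basis (sender's qudits, receiver's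
   halves). *)
Definition eainput (n k c : nat) (psi : 'cV[C]_#|qbasis 'I_k|) :
    'cV[C]_#|{: qbasis (sender n k c) * qbasis 'I_c}| :=
  ket (fun xy : qbasis (sender n k c) * qbasis 'I_c =>
    amp psi [ffun i => xy.1 (inl (inl i))] *
    (\prod_j ket0_amp (xy.1 (inl (inr j)))) *
    (\prod_j phi_amp (xy.1 (inr j)) (xy.2 j))).

(* Q is an [[n, k, d; c]]_q code.  As in the Knill-Laflamme-type definition
   used here, d is a distance that Q achieves, not necessarily the largest. *)
Definition is_eaqecc (n k d c : nat)
    (Q : {vspace 'cV[C]_#|{: qbasis (sender n k c) * qbasis 'I_c}|}) : Prop :=
  [/\ (k + c <= n)%N,
      (exists2 U : 'M[C]_#|qbasis (sender n k c)|, U \is unitarymx &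
        forall v, v \in Q <->
          exists psi, v = tens_op U 1%:M *m eainput n c psi) &
      (exists2 P, orth_projector P Q &
        forall (S : {set sender n k c}) (E : 'M[C]_#|qbasis (sender n k c)|),
          (#|S| < d)%N -> supported_on S E ->
          exists lambda : C, P *m tens_op E 1%:M *m P = lambda *: P)].

End Qudits.

(* Main.v *)
(* The distance of an entanglement-assisted code concerns errors on the sender's
   qudits only, and an error on a sender's half of a maximally entangled pair
   acts on the code as a scalar: <Phi|(E (x) I)|Phi> = tr E / q.  Hence it
   suffices to tensor the Hermitian [[n, 2k - n, d]] stabilizer code of C with
   c entangled pairs, and d' = d.

   The stabilizer code is the joint eigenspace of the Weyl operators W_u, u in
   the Hermitian dual of C, which commute because W_u W_v = chi(<u, v>) W_v W_u,
   where <u, v> is the Hermitian form and chi an additive character of F trivial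
   on the subfield of order q.  A local error is a combination of operators W_e
   with e of weight less than d; if e <> 0, then e is not in C, so W_e does not
   commute with some stabilizer and is annihilated by P _ P. *)

Require Import Defs.
From mathcomp Require Import all_boot all_order all_algebra all_fingroup all_field.
From mathcomp Require Import spectral complex.
From mathcomp Require Import reals.
From mathcomp Require Import ring zify.

Set Implicit Arguments.
Unset Strict Implicit.
Unset Printing Implicit Defensive.

Import Order.TTheory GRing.Theory Num.Theory.
Local Open Scope ring_scope.
Local Open Scope sesquilinear_scope.

(** * The field with q^2 elements *)

(** Take a root of 1 + X + ... + X^(p-1). It is not 1, where the value is [p], and a Bezout relation
    then excludes every smaller exponent. *)
Lemma prime_root_of_unity (C : numClosedFieldType) (p : nat) :
  prime p ->
  exists2 z : C, z ^+ p = 1 & forall j : nat, (0 < j < p)%N -> z ^+ j != 1.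
Proof.
move=> p_pr; pose r : {poly C} := \sum_(i < p) 'X^i.
have r1 : r.[1] = p%:R.
  rewrite /r horner_sum (eq_bigr (fun=> 1)) ?sumr_const ?card_ord // => i _.
  by rewrite hornerXn expr1n.
have szr : size r = p.
  have -> : r = \poly_(i < p) 1.
    by rewrite poly_def; apply: eq_bigr => i _; rewrite scale1r.
  by rewrite size_poly_eq ?oner_eq0.
have /closed_rootP [z /eqP rz] : size r != 1%N.
  by rewrite szr neq_ltn prime_gt1 // orbT.
have zp : z ^+ p = 1.
  apply/eqP; rewrite -subr_eq0 subrX1; apply/eqP.
  suff -> : \sum_(i < p) z ^+ i = r.[z] by rewrite rz mulr0.
  by rewrite horner_sum; apply: eq_bigr => i _; rewrite hornerXn.
have z1 : z != 1.
  apply: contra_eq_neq rz => ->; rewrite r1 pnatr_eq0.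
  by rewrite -lt0n prime_gt0.
exists z => // j /andP[j_gt0 j_ltp]; apply: contraNneq z1 => zj.
have /eqP cop : coprime p j by rewrite prime_coprime // gtnNdvd.
have [u v uv _] := egcdnP p j_gt0.
have := congr1 (fun k => z ^+ k) uv.
rewrite gcdnC cop mulnC exprM zj expr1n exprD mulnC exprM zp expr1n mul1r expr1.
by move=> <-.
Qed.

(** View [F] as a vector space over its prime field and raise a [p]-th root of unity to a coordinate
    that does not vanish at 1. *)
Lemma additive_character (C : numClosedFieldType) (F : finFieldType) :
  exists psi : F -> C, [/\ {morph psi : x y / x + y >-> x * y},
    psi 1 != 1 & forall x, `|psi x| = 1].
Proof.
have [p p_pr pF] := finPcharP F.
have [z zp zN] := prime_root_of_unity C p_pr.
pose V := pPrimeCharType pF : vectType 'F_p.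
pose X := vbasis {:V}.
have [i Xi] : exists i, coord X i (1 : F) != 0.
  apply/existsP; apply: contraT => /existsPn X0.
  have /eqP : (1 : F) = 0 :> V; last by rewrite oner_eq0.
  rewrite (coord_vbasis (memvf (1 : V))) big1 // => j _.
  by move: (X0 j); rewrite negbK => /eqP ->; rewrite scale0r.
have ltp (x : 'F_p) : (x < p)%N.
  by have := ltn_ord x; rewrite [X in (_ < X)%N](Fp_cast p_pr).
have modp (x : nat) : z ^+ (x %% p) = z ^+ x.
  by rewrite {2}(divn_eq x p) exprD mulnC exprM zp expr1n mul1r.
exists (fun x : F => z ^+ (coord X i (x : V) : 'F_p)); split.
- move=> x y; have -> : coord X i (x + y : F) = coord X i (x : V) + coord X i (y : V).
    exact: (linearD (coord X i)).
  by rewrite -exprD -[RHS]modp; congr (z ^+ (_ %% _)); rewrite Fp_cast.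
- by apply: zN; rewrite ltp andbT lt0n; apply: contra Xi => /eqP h; apply/eqP/val_inj.
- move=> x; rewrite normrX; suff -> : `|z| = 1 by rewrite expr1n.
  by apply/eqP; rewrite -(@pexpr_eq1 _ _ p) ?prime_gt0 // -normrX zp normr1.
Qed.

Section QuadraticExtension.
Variables (F : finFieldType) (q : nat).
Hypothesis q_pow : exists p m : nat, [/\ prime p, (0 < m)%N & q = (p ^ m)%N].
Hypothesis card_F : #|F| = (q ^ 2)%N.

Lemma prime_power_gt0 : (0 < q)%N.
Proof. by have [p [m [p_pr _ ->]]] := q_pow; rewrite expn_gt0 prime_gt0. Qed.

Lemma frobD (x y : F) : (x + y) ^+ q = x ^+ q + y ^+ q.
Proof.
have [p [m [p_pr m0 qE]]] := q_pow.
have pF : p \in [pchar F].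
  by apply: (@card_finPcharP _ p (m * 2)) => //; rewrite card_F qE -expnM.
apply: exprDn_pchar; rewrite qE pnatX; apply/orP; left.
by rewrite pnatE.
Qed.

Lemma frob0 : 0 ^+ q = 0 :> F.
Proof. by rewrite expr0n gtn_eqF ?prime_power_gt0. Qed.

Lemma frobN (x : F) : (- x) ^+ q = - x ^+ q.
Proof. by apply/eqP; rewrite -addr_eq0 -frobD addNr frob0. Qed.

Lemma frobB (x y : F) : (x - y) ^+ q = x ^+ q - y ^+ q.
Proof. by rewrite frobD frobN. Qed.

Lemma frob_sum (I : Type) (r : seq I) (P : pred I) (f : I -> F) :
  (\sum_(i <- r | P i) f i) ^+ q = \sum_(i <- r | P i) f i ^+ q.
Proof.
by elim/big_rec2: _ => [|i x y _ <-]; rewrite ?frob0 // frobD.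
Qed.

Lemma frobK (x : F) : (x ^+ q) ^+ q = x.
Proof. by rewrite -exprM -[(q * q)%N]/(q ^ 2)%N -card_F expf_card. Qed.

Definition fixed_field := [set x : F | x ^+ q == x].

(* The additive map [x + x ^+ q] has image in the fixed field; its fibres and
   the fixed field are sets of roots of polynomials of degree [q]. *)
Lemma card_fixed_field : #|fixed_field| = q.
Proof.
have q1 : (1 < q)%N.
  have := finNzRing_gt1 F; rewrite card_F; case: (q) prime_power_gt0 => [//|[|?]] //.
have roots (e : F) (y : F) : (#|[set x : F | (x ^+ q + e * x == y)%R]| <= q)%N.
  pose r : {poly F} := 'X^q + (e *: 'X - y%:P).
  have sz : size r = q.+1.
    rewrite size_addl size_polyXn // ltnS (leq_trans (size_polyD _ _)) //.
    rewrite size_polyN geq_max (leq_trans (size_scale_leq _ _)) ?size_polyX //.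
    by rewrite (leq_trans (size_polyC_leq1 _)) // ltnW.
  rewrite cardE -ltnS -sz max_poly_roots ?enum_uniq //.
    by rewrite -size_poly_eq0 sz.
  apply/allP => x; rewrite mem_enum inE /root /r !hornerE => /eqP <-.
  exact/eqP/subrr.
have le : (#|fixed_field| <= q)%N.
  have := roots (-1) 0; congr (_ <= _)%N; apply: eq_card => x.
  by rewrite !inE mulN1r subr_eq0.
apply/eqP; rewrite eqn_leq le /= -(leq_pmul2l prime_power_gt0).
rewrite -[(q * q)%N]/(q ^ 2)%N -card_F -sum1_card.
rewrite (partition_big (fun x => x ^+ q + x) (mem fixed_field)) /=; last first.
  by move=> x _; rewrite inE frobD frobK addrC.
rewrite mulnC -sum_nat_const leq_sum // => y _; rewrite sum1dep_card.
have := roots 1 y; congr (_ <= _)%N; apply: eq_card => x.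
by rewrite !inE mul1r.
Qed.

(** The enumeration lets the fixed field label the computational basis of one qudit. *)
Lemma fixed_field_enum : exists e : 'I_q -> F,
  injective e /\ forall x, x ^+ q = x <-> exists i, x = e i.
Proof.
exists (fun i => enum_val (cast_ord (esym card_fixed_field) i)); split.
  by move=> i j /enum_val_inj /cast_ord_inj.
move=> x; split=> [xq|[i ->]]; last first.
  by apply/eqP; have := enum_valP (cast_ord (esym card_fixed_field) i); rewrite inE.
have xK : x \in fixed_field by rewrite inE xq.
exists (cast_ord card_fixed_field (enum_rank_in xK x)).
by rewrite cast_ordK enum_rankK_in.
Qed.

Lemma non_fixed : exists g : F, g ^+ q != g.
Proof.
apply/existsP; apply: contraT => /existsPn h.
have : #|F| = q.
  rewrite -[RHS]card_fixed_field -cardsT; apply: eq_card => x; rewrite !inE.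
  by have := h x; rewrite negbK => ->.
rewrite card_F => qq; have := finNzRing_gt1 F; rewrite card_F qq => q1.
by move/eqP: qq; rewrite -[X in _ == X]expn1 eqn_exp2l.
Qed.

End QuadraticExtension.

(** * Dimension and biduality of the Hermitian dual *)

Section HermitianDual.
Variables (F : finFieldType) (q : nat).
Hypothesis q_pow : exists p m : nat, [/\ prime p, (0 < m)%N & q = (p ^ m)%N].
Hypothesis card_F : #|F| = (q ^ 2)%N.
Variable n : nat.
Implicit Type C : {vspace 'rV[F]_n}.

Lemma dim_rV_leq C : (\dim C <= n)%N.
Proof. by have := dimvS (subvf C); rewrite dimvf dim_matrix [(1 * n)%R]mul1r. Qed.

(** The dual is the kernel of the map given by a generator matrix of [C] with entries raised to the
    power [q]; that matrix has full rank, so rank-nullity applies. *)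
Lemma dim_herm_dual C : \dim (herm_dual q C) = (n - \dim C)%N.
Proof.
pose r := \dim C; pose b := vbasis C.
pose B : 'M[F]_(r, n) := \matrix_(i, j) (tnth b i) 0 j.
pose Bq : 'M[F]_(r, n) := \matrix_(i, j) B i j ^+ q.
pose f := linfun (mulmxr Bq^T) : 'Hom('rV[F]_n, 'rV[F]_r).
have fE v i : f v 0 i = \sum_j v 0 j * (tnth b i) 0 j ^+ q.
  by rewrite lfunE /= mxE; apply: eq_bigr => j _; rewrite !mxE.
have kerE : herm_dual q C = lker f.
  apply/vspaceP => v; rewrite memv_ker; apply/herm_dualP/eqP => [vC|fv0 w wC].
    by apply/rowP => i; rewrite fE mxE vC // vbasis_mem // mem_tnth.
  have wE j : w 0 j = \sum_(i < r) coord b i w * (tnth b i) 0 j.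
    rewrite {1}(coord_vbasis wC) summxE; apply: eq_bigr => i _.
    by rewrite mxE (tnth_nth 0).
  under eq_bigr => j _ do rewrite wE (frob_sum q_pow card_F) mulr_sumr.
  rewrite exchange_big big1 //= => i _.
  under eq_bigr => j _ do rewrite exprMn mulrCA.
  by rewrite -mulr_sumr -fE fv0 mxE mulr0.
have free_B : row_free B.
  rewrite -kermx_eq0; apply/rowV0P => w /sub_kermxP wB.
  have /freeP := basis_free (vbasisP C) => /(_ (fun i => w 0 i)) h.
  apply/rowP => i; rewrite mxE; apply: h; apply/rowP => j.
  have /rowP/(_ j) := wB; rewrite mxE [RHS]mxE => wj.
  rewrite summxE [RHS]mxE -[RHS]wj.
  by apply: eq_bigr => k _; rewrite !mxE (tnth_nth 0).
(* Frobenius is an involution, so it turns a dependency among the rows of [Bq] into one among the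
   rows of [B]. *)
have free_Bq : row_free Bq.
  rewrite -kermx_eq0; apply/rowV0P => w /sub_kermxP wB.
  pose w' : 'rV[F]_r := \row_i w 0 i ^+ q.
  suff /rowP w'0 : w' = 0.
    apply/rowP => i; have := w'0 i; rewrite !mxE => wi.
    by rewrite -[LHS](frobK card_F) wi (frob0 _ q_pow).
  apply: (row_free_inj free_B); rewrite mul0mx; apply/rowP => j.
  have /rowP/(_ j) := wB; rewrite mxE [RHS]mxE => wj; rewrite mxE [RHS]mxE.
  rewrite -[LHS](frobK card_F) (frob_sum q_pow card_F).
  rewrite -[RHS](frob0 _ q_pow) -[in RHS]wj; congr (_ ^+ q).
  by apply: eq_bigr => k _; rewrite !mxE exprMn (frobK card_F).
have im_f : (f @: fullv)%VS = fullv.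
  apply/eqP; rewrite eqEsubv subvf; apply/subvP => w _.
  have /submxP[v vE] : (w <= Bq^T)%MS by rewrite submx_full // /row_full mxrank_tr.
  by apply/memv_imgP; exists v; rewrite ?memvf // lfunE.
have := limg_ker_dim f fullv; rewrite capfv -kerE im_f !dimvf !dim_matrix.
rewrite [(1 * n)%R]mul1r [(1 * r)%R]mul1r => nE.
by have := congr1 (fun k => (k - r)%N) nE; rewrite addnK.
Qed.

(** Frobenius exchanges the two arguments of the form, so orthogonality is symmetric. *)
Lemma sub_herm_dual_dual C : (C <= herm_dual q (herm_dual q C))%VS.
Proof.
apply/subvP => v vC; apply/herm_dualP => w /herm_dualP /(_ v vC) wv.
rewrite -[LHS](frobK card_F) -[RHS](frob0 _ q_pow) -[in RHS]wv.
rewrite (frob_sum q_pow card_F); congr (_ ^+ q); apply: eq_bigr => i _.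
by rewrite exprMn (frobK card_F) mulrC.
Qed.

(** The inclusion of [C] in its bidual is an equality by comparison of dimensions. *)
Lemma herm_dualK C : herm_dual q (herm_dual q C) = C.
Proof.
apply/esym/eqP; rewrite eqEdim sub_herm_dual_dual !dim_herm_dual.
by rewrite leq_subLR addnC -leq_subLR /=.
Qed.

End HermitianDual.

(** * Weyl operators on one qudit *)

Section Characters.
Variables (C : numClosedFieldType) (F : finFieldType) (psi : F -> C).
Hypothesis psiD : {morph psi : x y / x + y >-> x * y}.
Hypothesis psi_norm : forall x, `|psi x| = 1.

Lemma char_neq0 x : psi x != 0.
Proof. by rewrite -normr_gt0 psi_norm ltr01. Qed.

Lemma char0 : psi 0 = 1.
Proof.
by apply: (mulfI (char_neq0 0)); rewrite -psiD addr0 mulr1.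
Qed.

Lemma charN x : psi (- x) = (psi x)^*.
Proof.
apply: (mulfI (char_neq0 x)); rewrite -psiD subrr char0.
by rewrite -normCK psi_norm expr1n.
Qed.

Lemma char_sum (I : Type) (r : seq I) (P : pred I) (f : I -> F) :
  psi (\sum_(i <- r | P i) f i) = \prod_(i <- r | P i) psi (f i).
Proof. exact: (big_morph psi psiD char0). Qed.

End Characters.

Section Weyl.
Variables (C : numClosedFieldType) (F : finFieldType) (q : nat).
Hypothesis q_pow : exists p m : nat, [/\ prime p, (0 < m)%N & q = (p ^ m)%N].
Hypothesis card_F : #|F| = (q ^ 2)%N.
Variables (psi : F -> C) (e : 'I_q -> F) (g : F).
Hypothesis psiD : {morph psi : x y / x + y >-> x * y}.
Hypothesis psi1 : psi 1 != 1.
Hypothesis psi_norm : forall x, `|psi x| = 1.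
Hypothesis e_inj : injective e.
Hypothesis eP : forall x, x ^+ q = x <-> exists i, x = e i.
Hypothesis gP : g ^+ q != g.

(* The coordinates of [x] in the basis [1, g] of [F] over its subfield of
   order [q]. *)
Definition crd1 (x : F) := (x - x ^+ q) / (g - g ^+ q).
Definition crd0 (x : F) := x - g * crd1 x.

Let fq := frobK card_F.
Let fqD := frobD q_pow card_F.
Let fqB := frobB q_pow card_F.

Lemma crd_denom_neq0 : g - g ^+ q != 0.
Proof. by rewrite subr_eq0 eq_sym. Qed.

Lemma crd1D : {morph crd1 : x y / x + y}.
Proof.
move=> x y; rewrite /crd1 fqD -mulrDl; congr (_ / _).
by rewrite opprD addrACA.
Qed.

Lemma crd0D : {morph crd0 : x y / x + y}.
Proof. by move=> x y; rewrite /crd0 crd1D mulrDr opprD addrACA. Qed.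

Lemma crd1_0 : crd1 0 = 0.
Proof. by apply: (addrI (crd1 0)); rewrite -crd1D !addr0. Qed.
Lemma crd0_0 : crd0 0 = 0.
Proof. by rewrite /crd0 crd1_0 mulr0 subr0. Qed.
Lemma crd1N x : crd1 (- x) = - crd1 x.
Proof. by apply/eqP; rewrite -addr_eq0 -crd1D addNr crd1_0. Qed.
Lemma crd0N x : crd0 (- x) = - crd0 x.
Proof. by apply/eqP; rewrite -addr_eq0 -crd0D addNr crd0_0. Qed.

(** Frobenius changes the sign of both numerator and denominator. *)
Lemma crd1_fixed x : crd1 x ^+ q = crd1 x.
Proof.
rewrite /crd1 expr_div_n !fqB !fq -[x ^+ q - x]opprB -[g ^+ q - g]opprB.
by rewrite invrN mulrNN.
Qed.

Lemma crd0_fixed x : crd0 x ^+ q = crd0 x.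
Proof.
rewrite /crd0 fqB exprMn crd1_fixed.
have /(canRL (mulfVK crd_denom_neq0)) h := erefl (crd1 x).
have xq : x - x ^+ q = g * crd1 x - g ^+ q * crd1 x by rewrite -mulrBl mulrC -h.
have -> : x ^+ q = x - (g * crd1 x - g ^+ q * crd1 x) by rewrite -xq opprB addrC subrK.
by rewrite opprB addrA addrAC addrK.
Qed.

Lemma crdK x : crd0 x + g * crd1 x = x.
Proof. by rewrite subrK. Qed.

Lemma crd1E i j : crd1 (e i + g * e j) = e j.
Proof.
have ei k : e k ^+ q = e k by apply/eP; exists k.
rewrite /crd1 fqD exprMn !ei opprD addrACA subrr add0r -mulrBl mulrAC.
by rewrite divff ?crd_denom_neq0 // mul1r.
Qed.

Lemma crd0E i j : crd0 (e i + g * e j) = e i.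
Proof. by rewrite /crd0 crd1E addrK. Qed.

(** The symplectic form on coordinates depends only on the Hermitian product [x * y ^+ q]. This
    links commutation of Weyl operators to Hermitian duality. *)
Lemma crd_det x y :
  crd1 x * crd0 y - crd1 y * crd0 x = (x * y ^+ q - (x * y ^+ q) ^+ q) / (g - g ^+ q).
Proof.
rewrite /crd0 /crd1 exprMn fq; move: (x ^+ q) (y ^+ q) (g - _)^-1 => x' y' d'.
ring.
Qed.

Lemma fixed_unit b : b ^+ q = b -> b != 0 -> exists j, b * e j = 1.
Proof.
move=> bq b0; have /eP[j jE] : (b^-1) ^+ q = b^-1 by rewrite exprVn bq.
by exists j; rewrite -jE divff.
Qed.

Lemma fixed_shift b : b ^+ q = b ->
  exists2 s : 'I_q -> 'I_q, bijective s & forall i, e (s i) = e i + b.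
Proof.
move=> bq.
have ex i : exists j, e j == e i + b.
  have /eP[j ->] : (e i + b) ^+ q = e i + b; last by exists j.
  by rewrite fqD bq; congr (_ + _); apply/eP; exists i.
pose s i := xchoose (ex i).
have sE i : e (s i) = e i + b by apply/eqP; exact: (xchooseP (ex i)).
exists s => //; apply: injF_bij => i j /(congr1 e).
by rewrite !sE => /addIr /e_inj.
Qed.

(** For [b] nonzero, shifting the summation index by the inverse of [b] multiplies the sum by
    [psi 1], which is not 1. *)
Lemma sum_char b : b ^+ q = b -> \sum_i psi (b * e i) = q%:R * (b == 0)%:R.
Proof.
move=> bq; have [->|b0] := eqVneq b 0.
  rewrite mulr1 (eq_bigr (fun=> 1)) ?sumr_const ?card_ord // => i _.
  by rewrite mul0r (char0 psiD psi_norm).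
rewrite mulr0; have [j bj] := fixed_unit bq b0.
have [|s s_bij sE] := @fixed_shift (e j); first by apply/eP; exists j.
set S := \sum_i _; have SE : S = psi 1 * S.
  rewrite {1}/S (reindex s) /=; last exact: onW_bij.
  by rewrite mulr_sumr; apply: eq_bigr => i _; rewrite sE mulrDr psiD bj mulrC.
apply/eqP; move/eqP: SE; rewrite -{1}[S]mul1r -subr_eq0 -mulrBl mulf_eq0.
by rewrite subr_eq0 eq_sym (negbTE psi1).
Qed.

(** The generalized Pauli operator X(a)Z(b) with a = [crd0 x] and b = [crd1 x]: first the phase,
    then the shift, on basis states labelled by the fixed field. *)
Definition weyl (x : F) (s t : 'I_q) : C :=
  (e s == e t + crd0 x)%:R * psi (crd1 x * e t).

Lemma weyl0 s t : weyl 0 s t = (s == t)%:R.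
Proof.
by rewrite /weyl crd0_0 crd1_0 mul0r (char0 psiD psi_norm) mulr1 addr0 (inj_eq e_inj).
Qed.

(** The scalar arises from moving the phase part of [x] past the shift part of [y]. *)
Lemma weylM x y s r :
  \sum_t weyl x s t * weyl y t r = psi (crd1 x * crd0 y) * weyl (x + y) s r.
Proof.
have [sh _ shE] := fixed_shift (crd0_fixed y).
rewrite (bigD1 (sh r)) //= big1 => [|t tr]; last first.
  rewrite /weyl -shE (inj_eq e_inj) (negbTE tr) mul0r mulr0 //.
rewrite addr0 /weyl shE eqxx mul1r crd0D crd1D mulrDl mulrDr !psiD.
by rewrite -addrA [crd0 y + _]addrC; ring.
Qed.

Lemma weyl_conj x s t :
  (weyl x t s)^* = psi (crd1 x * crd0 x) * weyl (- x) s t.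
Proof.
rewrite /weyl rmorphM /=. rewrite rmorph_nat -(charN psiD psi_norm) crd0N crd1N.
rewrite [in RHS]eq_sym subr_eq.
have [->|] := eqVneq (e t) (e s + crd0 x); last by rewrite !mul0r mulr0.
by rewrite !mul1r -psiD; congr psi; ring.
Qed.

(** A nonzero shift has an empty diagonal, and a pure phase sums to zero by [sum_char]. *)
Lemma weyl_tr x : \sum_t weyl x t t = q%:R * (x == 0)%:R.
Proof.
rewrite /weyl.
have -> : (x == 0) = (crd0 x == 0) && (crd1 x == 0).
  apply/eqP/andP => [->|[/eqP x0 /eqP x1]]; first by rewrite crd0_0 crd1_0.
  by rewrite -(crdK x) x0 x1 mulr0 addr0.
under eq_bigr => t _ do rewrite -{1}[e t]addr0 (inj_eq (addrI _)) eq_sym.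
rewrite -mulr_sumr sum_char ?crd1_fixed // mulrCA.
by case: (crd0 x == 0); rewrite ?mul1r ?mul0r ?mulr0.
Qed.

(** This completeness relation expands every matrix unit in Weyl operators. Summing over the phase
    coordinate forces [t = t']; then exactly one shift takes [t'] to [s'], and it must also give
    [s]. *)
Lemma weyl_complete s t s' t' :
  \sum_x (weyl x s' t')^* * weyl x s t = q%:R * ((s == s') && (t == t'))%:R.
Proof.
pose h (ij : 'I_q * 'I_q) := e ij.1 + g * e ij.2.
have h_inj : injective h.
  move=> [i j] [i' j'] hh; congr (_, _); apply: e_inj.
    by rewrite -(crd0E i j) -(crd0E i' j') -/(h (i, j)) hh.
  by rewrite -(crd1E i j) -(crd1E i' j') -/(h (i, j)) hh.
rewrite (reindex h) /=; last first.
  by apply/onW_bij/inj_card_bij => //; rewrite card_F card_prod card_ord.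
under eq_bigr => ij _.
  rewrite /weyl /h crd0E crd1E rmorphM /= rmorph_nat -(charN psiD psi_norm).
  rewrite mulrACA -psiD -mulrN -mulrDr [e ij.2 * _]mulrC.
  over.
rewrite -(pair_bigA _ (fun i j => (e s' == e t' + e i)%:R * (e s == e t + e i)%:R *
   psi ((- e t' + e t) * e j))) /=.
under eq_bigr => i _.
  rewrite -mulr_sumr sum_char; last first.
    by rewrite addrC fqB; congr (_ - _); apply/eP; [exists t|exists t'].
  over.
rewrite -mulr_suml mulrCA; congr (_ * _).
rewrite addrC subr_eq0 (inj_eq e_inj) mulrC.
have [->|] := eqVneq t t'; last by rewrite andbF mul0r.
rewrite andbT mul1r.
have [i iE] : exists i, e s = e t' + e i.
  have /eP[i /eqP] : (e s - e t') ^+ q = e s - e t'.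
    by rewrite fqB; congr (_ - _); apply/eP; [exists s|exists t'].
  by rewrite subr_eq addrC => /eqP; exists i.
rewrite (bigD1 i) //= big1 ?addr0 => [|j ji].
  by rewrite iE eqxx mulr1 -iE (inj_eq e_inj) eq_sym.
by rewrite iE (inj_eq (addrI _)) (inj_eq e_inj) [i == j]eq_sym (negbTE ji) mulr0.
Qed.

End Weyl.

(** * Stabilizer projectors *)

Lemma big_rank (C : nmodType) (T : finType) (f : 'I_#|T| -> C) :
  \sum_i f i = \sum_(x : T) f (enum_rank x).
Proof. by rewrite (reindex enum_rank) //; apply/onW_bij/enum_rank_bij. Qed.

Lemma adjmxM (C : numClosedFieldType) m n p (A : 'M[C]_(m, n)) (B : 'M[C]_(n, p)) :
  (A *m B)^t* = B^t* *m A^t*.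
Proof. by rewrite trmx_mul map_mxM. Qed.

Section Stabilizer.
Variables (C : numClosedFieldType) (N : nat) (V : finZmodType) (D : {set V}).
Variables (W : V -> 'M[C]_N) (beta : V -> V -> C).
Hypothesis N_gt0 : (0 < N)%N.
Hypothesis D0 : 0 \in D.
Hypothesis DD : {in D &, forall u v, u + v \in D}.
Hypothesis DN : {in D, forall u, - u \in D}.
Hypothesis WM : forall u v, W u *m W v = beta u v *: W (u + v).
Hypothesis W0 : W 0 = 1%:M.
Hypothesis W_adj : forall u, (W u)^t* = beta u u *: W (- u).
Hypothesis W_tr : forall u, \tr (W u) = N%:R * (u == 0)%:R.
Hypothesis betaN : forall u, beta u (- u) = (beta u u)^*.
Hypothesis beta_norm : forall u, `|beta u u| = 1.
Hypothesis D_isotropic : {in D &, forall u v, beta u v = beta v u}.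

(* The phases [chi] are the eigenvalues on a common eigenvector of the commuting
   operators [W u], [u] in [D]; this avoids choosing square roots of [beta],
   which would require separate treatment in characteristic 2. *)
Lemma stabilizer_character : exists chi : V -> C,
  [/\ chi 0 = 1, {in D, forall u, `|chi u| = 1} &
      {in D &, forall u v, chi u * chi v = beta u v * chi (u + v)}].
Proof.
have [] := @common_eigenvector C N [seq W u | u <- enum D] N_gt0.
  move=> _ _ /mapP[u + ->] /mapP[v + ->]; rewrite !mem_enum => uD vD.
  by rewrite /comm_mx !WM addrC D_isotropic.
move=> v v0 /allP st.
have [j vj] : exists j, v 0 j != 0.
  apply/existsP; apply: contraNT v0 => /existsPn v0; apply/eqP/rowP => j.
  by rewrite mxE; have := v0 j; rewrite negbK => /eqP.
have [chi chiE] : exists chi, {in D, forall u, v *m W u = chi u *: v}.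
  exists (fun u => (v *m W u) 0 j / v 0 j) => u uD.
  have /st /sub_rVP[a aE] : W u \in [seq W u | u <- enum D].
    by apply/mapP; exists u; rewrite ?mem_enum.
  by rewrite aE mxE mulfK.
have injv a b : a *: v = b *: v -> a = b.
  by move/rowP/(_ j); rewrite !mxE => /(mulIf vj).
exists chi; split.
- by apply: injv; rewrite -chiE // W0 mulmx1 scale1r.
(* [W u] is unitary, so the norms of [v] and of [v *m W u] agree, which gives [chi u] modulus 1. *)
- move=> u uD; have : (v *m W u) *m (v *m W u)^t* = v *m v^t*.
    rewrite adjmxM mulmxA -(mulmxA v) W_adj -scalemxAr WM scalerA subrr W0.
    by rewrite betaN -normCK beta_norm expr1n scale1r mulmx1.
  rewrite chiE // linearZ /= map_mxZ -scalemxAl -scalemxAr scalerA.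
  move/matrixP/(_ 0 0); rewrite mxE -normCK => h.
  apply/eqP; rewrite -(@pexpr_eq1 _ _ 2) //; apply/eqP.
  apply: (@mulIf _ ((v *m v^t*) 0 0)); last by rewrite h mul1r.
  rewrite mxE psumr_neq0 => [|i _]; last by rewrite !mxE -normCK exprn_ge0.
  apply/hasP; exists j; first exact: mem_index_enum.
  by rewrite /= !mxE -normCK exprn_gt0 // normr_gt0.
- move=> u w uD wD; apply: injv; rewrite -!scalerA -!chiE ?DD //.
  by rewrite scalemxAl -chiE // -mulmxA WM scalemxAr.
Qed.

(** [P] averages the operators [W u], corrected by their eigenvalues, over the group [D]; it absorbs
    each [W w] into the scalar [chi w] on either side. Only [u = 0] contributes to the trace. *)
Lemma stabilizer_projector : exists P : 'M[C]_N,
  [/\ P *m P = P, P^t* = P, \tr P = N%:R / #|D|%:R &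
      forall e, (exists2 w, w \in D & beta e w != beta w e) -> P *m W e *m P = 0].
Proof.
have [chi [chi0 chi_norm chiM]] := stabilizer_character.
have chi_neq0 u : u \in D -> chi u != 0.
  by move=> uD; rewrite -normr_gt0 chi_norm ?ltr01.
have chiV u : u \in D -> chi u * (chi u)^* = 1.
  by move=> uD; rewrite -normCK chi_norm ?expr1n.
pose P := #|D|%:R^-1 *: \sum_(u in D) (chi u)^* *: W u.
have cardD : #|D|%:R != 0 :> C.
  by rewrite pnatr_eq0 -lt0n; apply/card_gt0P; exists 0.
have D_shift w u : w \in D -> (w + u \in D) = (u \in D).
  move=> wD; apply/idP/idP => [h|]; last exact: DD.
  by rewrite -(addKr w u) DD ?DN.
have WP w : w \in D -> W w *m P = chi w *: P.
  move=> wD; rewrite -scalemxAr scalerA mulrC -scalerA; congr (_ *: _).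
  (* Translation by [w] permutes [D], and [chiM] matches the phases term by term. *)
  rewrite mulmx_sumr scaler_sumr [RHS](reindex_inj (addrI w)) /=.
  apply: eq_big => [u|u uD]; first by rewrite D_shift.
  rewrite -scalemxAr WM !scalerA; congr (_ *: _).
  have wuD : w + u \in D by rewrite D_shift.
  apply: (mulIf (chi_neq0 _ wuD)); rewrite -mulrA -chiM // mulrCA.
  by rewrite -[RHS]mulrA [X in _ * X]mulrC chiV // [_^* * _]mulrC chiV.
have PW w : w \in D -> P *m W w = chi w *: P.
  move=> wD; rewrite -WP // -scalemxAl -scalemxAr; congr (_ *: _).
  rewrite mulmx_suml mulmx_sumr; apply: eq_bigr => u uD.
  by rewrite -scalemxAl -scalemxAr !WM addrC D_isotropic.
exists P; split.
- rewrite {2}/P -scalemxAr mulmx_sumr.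
  under eq_bigr => u uD do rewrite -scalemxAr PW // scalerA mulrC chiV // scale1r.
  by rewrite sumr_const -scaler_nat scalerA mulVf // scale1r.
- rewrite /P linearZ /= map_mxZ fmorphV rmorph_nat; congr (_ *: _).
  rewrite linear_sum /= map_mx_sum [RHS](reindex_inj oppr_inj) /=.
  apply: eq_big => [u|u uD].
    by apply/idP/idP => /DN; rewrite ?opprK.
  rewrite linearZ /= map_mxZ /= W_adj conjCK scalerA; congr (_ *: _).
  have uND := DN uD.
  apply: (mulIf (chi_neq0 _ uND)); rewrite [RHS]mulrC chiV //.
  rewrite mulrAC chiM // subrr chi0 mulr1 betaN mulrC -normCK beta_norm.
  by rewrite expr1n.
- rewrite /P linearZ /= linear_sum /= (bigD1 0) //= big1 => [|u /andP[_ u0]].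
    by rewrite linearZ /= W_tr eqxx chi0 conjC1 mulr1 mul1r addr0 mulrC.
  by rewrite linearZ /= W_tr (negbTE u0) !mulr0.
- move: P WP PW => P WP PW e [w wD ne].
  (* Absorbing [W w] on the right or on the left gives the same result, yet the two products are
     [beta e w] and [beta w e] times the same matrix. Hence that matrix vanishes, and with it
     [P *m W e *m P]. *)
  have hl : P *m (W e *m W w) *m P = chi w *: (P *m W e *m P).
    by rewrite mulmxA -mulmxA WP // -scalemxAr.
  have hr : P *m (W w *m W e) *m P = chi w *: (P *m W e *m P).
    by rewrite mulmxA PW // -!scalemxAl.
  have h : P *m W (e + w) *m P = 0.
    have : P *m (W e *m W w) *m P = P *m (W w *m W e) *m P by rewrite hl hr.
    rewrite !WM [w + e]addrC -!scalemxAr -!scalemxAl => /eqP.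
    by rewrite -subr_eq0 -scalerBl scaler_eq0 subr_eq0 (negbTE ne) => /eqP.
  move: hl; rewrite WM -scalemxAr -scalemxAl h scaler0 => /esym/eqP.
  by rewrite scaler_eq0 (negbTE (chi_neq0 _ wD)) => /eqP.
Qed.

End Stabilizer.

(** * Weyl operators on several qudits *)

Section TensorMatrices.
Variables (C : numClosedFieldType) (q : nat) (I : finType).
Local Notation T := (qbasis q I).

Definition tensor_mx (f : I -> 'I_q -> 'I_q -> C) : 'M[C]_#|T| :=
  \matrix_(i, j) \prod_k f k ((enum_val i : T) k) ((enum_val j : T) k).

Lemma eq_tensor_mx f h : (forall k s t, f k s t = h k s t) ->
  tensor_mx f = tensor_mx h.
Proof.
move=> fh; apply/matrixP=> i j; rewrite !mxE.
by apply: eq_bigr => k _; rewrite fh.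
Qed.

Lemma tensor_mxM f h :
  tensor_mx f *m tensor_mx h =
  tensor_mx (fun k s r => \sum_t f k s t * h k t r).
Proof.
apply/matrixP => i j; rewrite !mxE big_rank bigA_distr_bigA /=.
by apply: eq_bigr => x _; rewrite !mxE enum_rankK -big_split.
Qed.

Lemma tensor_mx_tr f : \tr (tensor_mx f) = \prod_k \sum_t f k t t.
Proof.
rewrite /mxtrace big_rank bigA_distr_bigA /=.
by apply: eq_bigr => x _; rewrite !mxE enum_rankK.
Qed.

Lemma tensor_mx1 : tensor_mx (fun _ s t => (s == t)%:R) = 1%:M.
Proof.
apply/matrixP => i j; rewrite !mxE; have [->|ij] := eqVneq i j.
  by rewrite big1 // => k _; rewrite eqxx.
have [k xk] : exists k, (enum_val i : T) k != (enum_val j : T) k.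
  apply/existsP; apply: contraNT ij => /existsPn h; apply/eqP/enum_val_inj/ffunP => k.
  by have := h k; rewrite negbK => /eqP.
by rewrite (bigD1 k) //= (negbTE xk) mul0r.
Qed.

Lemma tensor_mx_adj f : (tensor_mx f)^t* = tensor_mx (fun k s t => (f k t s)^*).
Proof. by apply/matrixP => i j; rewrite !mxE rmorph_prod. Qed.

Lemma tensor_mxZ (c : I -> C) f :
  tensor_mx (fun k s t => c k * f k s t) = (\prod_k c k) *: tensor_mx f.
Proof. by apply/matrixP => i j; rewrite !mxE big_split. Qed.

Lemma tensor_mx_sum (X : finType) (c : I -> X -> C)
    (f : X -> 'I_q -> 'I_q -> C) :
  tensor_mx (fun k s t => \sum_x c k x * f x s t) =
  \sum_(v : {ffun I -> X}) (\prod_k c k (v k)) *: tensor_mx (fun k => f (v k)).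
Proof.
apply/matrixP => i j; rewrite summxE !mxE bigA_distr_bigA /=.
by apply: eq_bigr => v _; rewrite !mxE big_split.
Qed.

End TensorMatrices.

(* By [wopM] and [wcocycle_swap], [wop x] and [wop y] commute up to the phase
   [wchar (x * y ^+ q)], a character of the Hermitian form. *)
Record weyl_system (C : numClosedFieldType) (F : finFieldType) (q : nat) :=
  WeylSystem {
  wop : F -> 'I_q -> 'I_q -> C;
  wcocycle : F -> F -> C;
  wchar : F -> C;
  wop0 : forall s t, wop 0 s t = (s == t)%:R;
  wopM : forall x y s r,
    \sum_t wop x s t * wop y t r = wcocycle x y * wop (x + y) s r;
  wop_conj : forall x s t, (wop x t s)^* = wcocycle x x * wop (- x) s t;
  wop_tr : forall x, \sum_t wop x t t = q%:R * (x == 0)%:R;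
  wop_complete : forall s t s' t',
    \sum_x (wop x s' t')^* * wop x s t = q%:R * ((s == s') && (t == t'))%:R;
  wcocycle_norm : forall x y, `|wcocycle x y| = 1;
  wcocycleN : forall x y, wcocycle x (- y) = (wcocycle x y)^*;
  wcocycle_swap : forall x y, wcocycle x y = wchar (x * y ^+ q) * wcocycle y x;
  wcharD : {morph wchar : x y / x + y >-> x * y};
  wchar_norm : forall x, `|wchar x| = 1;
  wchar_nontrivial : exists z, wchar z != 1
}.

Lemma weyl_system_exists (C : numClosedFieldType) (F : finFieldType) (q : nat) :
  (exists p m : nat, [/\ prime p, (0 < m)%N & q = (p ^ m)%N]) ->
  #|F| = (q ^ 2)%N -> inhabited (weyl_system C F q).
Proof.
move=> q_pow card_F.
have [psi [psiD psi1 psi_norm]] := additive_character C F.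
have [e [e_inj eP]] := fixed_field_enum q_pow card_F.
have [g gP] := non_fixed q_pow card_F.
(* The quotient is the coordinate [crd1] of [z], so [ch] is trivial on the fixed field. *)
pose ch z := psi ((z - z ^+ q) / (g - g ^+ q)).
apply: inhabits.
apply: (@WeylSystem C F q (weyl psi e g)
  (fun x y => psi (crd1 q g x * crd0 q g y)) ch).
- move=> s t; exact: (weyl0 q_pow card_F).
- move=> x y s r; exact: (weylM q_pow card_F).
- move=> x s t; exact: (weyl_conj q_pow card_F).
- move=> x; exact: (weyl_tr q_pow card_F).
- move=> s t s' t'; exact: (weyl_complete q_pow card_F).
- by [].
- by move=> x y; rewrite (crd0N q_pow card_F) mulrN (charN psiD psi_norm).
- move=> x y; rewrite /ch -psiD -(crd_det card_F) [crd1 q g y * _]mulrC.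
  by rewrite mulrC [crd1 q g y * _]mulrC subrK mulrC.
- by move=> x y; rewrite /ch (frobD q_pow card_F) -psiD; congr psi; ring.
- by move=> x; rewrite /ch.
(* At [g] the quotient is 1, and [psi 1] differs from 1. *)
- by exists g; rewrite /ch divff // subr_eq0 eq_sym.
Qed.

(** * Unitary diagonalization of projectors *)

Lemma perm_of_card_eq (T : finType) (A B : {set T}) :
  #|A| = #|B| -> exists s : {perm T}, forall x, (s x \in B) = (x \in A).
Proof.
(* Each list puts the set before its complement; the permutation matches entries in the same
   position. *)
move=> cAB; pose LA := enum A ++ enum (~: A); pose LB := enum B ++ enum (~: B).
have memL (X : {set T}) x : x \in enum X ++ enum (~: X).
  by rewrite mem_cat !mem_enum inE orbN.
have uniqL (X : {set T}) : uniq (enum X ++ enum (~: X)).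
  rewrite cat_uniq !enum_uniq /= andbT; apply/hasPn => x.
  by rewrite !mem_enum inE.
have szL (X : {set T}) : size (enum X ++ enum (~: X)) = #|T|.
  by rewrite size_cat -!cardE cardsC.
pose f x := nth x LB (index x LA).
have ltL x : (index x LA < size LB)%N by rewrite szL -(szL A) index_mem memL.
have f_inj : injective f.
  move=> x y; rewrite /f (set_nth_default y) // => /eqP.
  rewrite nth_uniq ?uniqL // => /eqP /(congr1 (nth x LA)).
  by rewrite nth_index ?memL // (set_nth_default y) ?index_mem ?memL // nth_index ?memL.
exists (perm f_inj) => x; rewrite permE /f /LA /LB index_cat mem_enum.
have [xA|xA] := boolP (x \in A).
  have lt : (index x (enum A) < size (enum B))%N.
    by rewrite -cardE -cAB cardE index_mem mem_enum.
  by rewrite nth_cat lt -mem_enum mem_nth.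
rewrite nth_cat -!cardE -cAB ltnNge leq_addr /= addKn.
have : nth x (enum (~: B)) (index x (enum (~: A))) \in enum (~: B).
  rewrite mem_nth // -cardE.
  have -> : #|~: B| = #|~: A| by apply/eqP; rewrite -(eqn_add2l #|A|) {1}cAB !cardsC.
  by rewrite cardE index_mem mem_enum inE.
by rewrite mem_enum inE => /negbTE.
Qed.

Section Projectors.
Variables (C : numClosedFieldType) (N : nat).

Definition diag_set (A : {set 'I_N}) : 'M[C]_N := diag_mx (\row_i (i \in A)%:R).

(** The spectral theorem gives eigenvalues 0 and 1, the trace counts the ones, and a permutation
    moves them to positions [A]. The free choice of [A] later allows the basis states with zero
    ancillas. *)
Lemma projector_diag (P : 'M[C]_N) (A : {set 'I_N}) :
  P *m P = P -> P^t* = P -> \tr P = #|A|%:R ->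
  exists2 U, U \is unitarymx & P = U *m diag_set A *m U^t*.
Proof.
move=> PP Padj trP; have Pn : P \is normalmx by apply/normalmxP; rewrite Padj.
pose S := spectralmx P; pose d := spectral_diag P.
have Su : S \is unitarymx := spectral_unitarymx P.
have PE : P = S^t* *m diag_mx d *m S.
  by rewrite -(invmx_unitary Su); exact/orthomx_spectralP.
have SSt : S *m S^t* = 1%:M by exact/unitarymxP.
have StS : S^t* *m S = 1%:M by rewrite -(invmx_unitary Su) mulVmx ?spectral_unit.
have dE : diag_mx d = S *m P *m S^t*.
  by rewrite PE !mulmxA SSt mul1mx -mulmxA SSt mulmx1.
have d01 i : d 0 i = (d 0 i == 1)%:R.
  have : diag_mx d *m diag_mx d = diag_mx d.
    by rewrite {1 2}dE !mulmxA -(mulmxA _ (S^t*) S) StS mulmx1 -(mulmxA _ P P) PP -dE.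
  rewrite mulmx_diag => /matrixP/(_ i i); rewrite !mxE eqxx !mulr1n.
  have [-> //|di] := eqVneq (d 0 i) 0; first by rewrite mul0r eq_sym oner_eq0.
  by rewrite -{3}[d 0 i]mulr1 => /(mulfI di) ->; rewrite eqxx.
pose B := [set i | d 0 i == 1].
have cAB : #|A| = #|B|.
  apply/eqP; rewrite -(eqr_nat C) -trP PE mxtrace_mulC mulmxA SSt mul1mx mxtrace_diag.
  rewrite -sum1_card natr_sum [X in _ == X]big_mkcond /=; apply/eqP/eq_bigr => i _.
  by rewrite inE {1}d01; case: (d 0 i == 1).
have [s sE] := perm_of_card_eq cAB.
pose U := S^t* *m (perm_mx s)^t*.
have pu : perm_mx s *m (perm_mx s)^t* = 1%:M :> 'M[C]_N.
  by rewrite tr_perm_mx map_perm_mx -perm_mxM mulgV perm_mx1.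
have pu' : (perm_mx s)^t* *m perm_mx s = 1%:M :> 'M[C]_N.
  by rewrite tr_perm_mx map_perm_mx -perm_mxM mulVg perm_mx1.
exists U.
  apply/unitarymxP; rewrite adjmxM !trmxCK mulmxA.
  by rewrite -(mulmxA _ ((perm_mx s)^t*) (perm_mx s)) pu' mulmx1.
have -> : diag_set A = perm_mx s *m diag_mx d *m (perm_mx s)^t*.
  rewrite tr_perm_mx map_perm_mx -row_permE -col_permE; apply/matrixP => i j.
  by rewrite !mxE (inj_eq perm_inj) -sE inE -d01.
rewrite adjmxM !trmxCK !mulmxA.
by do 2!rewrite -(mulmxA _ ((perm_mx s)^t*) (perm_mx s)) pu' mulmx1; rewrite -PE.
Qed.

End Projectors.

(** * The Hermitian construction *)

Lemma card_vspace_rV (F : finFieldType) n (D : {vspace 'rV[F]_n}) :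
  #|[set v in D]| = (#|F| ^ \dim D)%N.
Proof.
pose b := vbasis D; pose f (x : 'rV[F]_(\dim D)) := \sum_i x 0 i *: b`_i.
have f_inj : injective f.
  move=> x y /eqP; rewrite -subr_eq0 -sumrB => /eqP xy.
  have /freeP h := basis_free (vbasisP D).
  apply/rowP => i; apply/eqP; rewrite -subr_eq0; apply/eqP.
  apply: (h (fun i => x 0 i - y 0 i)); rewrite -[RHS]xy.
  by apply: eq_bigr => j _; rewrite scalerBl.
have -> : [set v in D] = [set f x | x in [set: 'rV[F]_(\dim D)]].
  apply/setP => v; rewrite inE; apply/idP/imsetP => [vD|[x _ ->]].
    exists (\row_i coord b i v); rewrite ?inE // {1}(coord_vbasis vD).
    by apply: eq_bigr => i _; rewrite mxE.
  by apply: memv_suml => i _; rewrite memvZ // vbasis_mem // mem_nth ?size_tuple.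
by rewrite card_imset // cardsT card_mx mul1n.
Qed.

Section HermitianCode.
Variables (C : numClosedFieldType) (F : finFieldType) (q : nat).
Variable (W : weyl_system C F q).
Hypothesis q_pow : exists p m : nat, [/\ prime p, (0 < m)%N & q = (p ^ m)%N].
Hypothesis card_F : #|F| = (q ^ 2)%N.
Variables (I : finType) (n : nat) (pos : I -> 'I_n).
Hypothesis pos_bij : bijective pos.
Local Notation T := (qbasis q I).

(** The qudit labels [I] will form a sum type; [pos] matches them with the code coordinates. *)
Definition wmx (u : 'rV[F]_n) : 'M[C]_#|T| :=
  tensor_mx (fun k => wop W (u 0 (pos k))).
Definition wmx_cocycle (u v : 'rV[F]_n) : C :=
  \prod_k wcocycle W (u 0 (pos k)) (v 0 (pos k)).

Lemma card_qbasis : #|T| = (q ^ n)%N.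
Proof. by rewrite card_ffun !card_ord (bij_eq_card pos_bij) card_ord. Qed.

Lemma wmxM u v : wmx u *m wmx v = wmx_cocycle u v *: wmx (u + v).
Proof.
rewrite tensor_mxM -tensor_mxZ; apply: eq_tensor_mx => k s t.
by rewrite wopM mxE.
Qed.

Lemma wmx0 : wmx 0 = 1%:M.
Proof. by rewrite -tensor_mx1; apply: eq_tensor_mx => k s t; rewrite mxE wop0. Qed.

Lemma wmx_adj u : (wmx u)^t* = wmx_cocycle u u *: wmx (- u).
Proof.
rewrite tensor_mx_adj -tensor_mxZ; apply: eq_tensor_mx => k s t.
by rewrite wop_conj mxE.
Qed.

Lemma wmx_tr u : \tr (wmx u) = #|T|%:R * (u == 0)%:R.
Proof.
rewrite tensor_mx_tr; under eq_bigr => k _ do rewrite wop_tr.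
rewrite big_split prodr_const card_ffun card_ord natrX; congr (_ * _).
have [->|u0] := eqVneq u 0; first by rewrite big1 // => k _; rewrite mxE eqxx.
have [j uj] : exists j, u 0 j != 0.
  apply/existsP; apply: contraNT u0 => /existsPn h; apply/eqP/rowP => j.
  by rewrite mxE; have := h j; rewrite negbK => /eqP.
have [pos' _ posK] := pos_bij.
by rewrite (bigD1 (pos' j)) //= posK (negbTE uj) mul0r.
Qed.

Lemma wmx_cocycle_norm u v : `|wmx_cocycle u v| = 1.
Proof. by rewrite normr_prod big1 // => k _; rewrite wcocycle_norm. Qed.

Lemma wmx_cocycleN u v : wmx_cocycle u (- v) = (wmx_cocycle u v)^*.
Proof. by rewrite rmorph_prod; apply: eq_bigr => k _; rewrite mxE wcocycleN. Qed.

(** Since [wchar] is a character, the phases of the single qudits multiply to its value at the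
    Hermitian form; orthogonal vectors thus give commuting operators. *)
Lemma wmx_cocycle_swap u v :
  wmx_cocycle u v = wchar W (\sum_i u 0 i * v 0 i ^+ q) * wmx_cocycle v u.
Proof.
rewrite (char_sum (@wcharD _ _ _ W) (@wchar_norm _ _ _ W)).
rewrite (reindex pos) /=; last exact: onW_bij.
by rewrite -big_split; apply: eq_bigr => k _; exact: wcocycle_swap.
Qed.

(** The stabilizer group is the Hermitian dual: containment in [Cd] makes it isotropic, and
    biduality supplies a noncommuting stabilizer for each [u] outside [Cd]. *)
Lemma hermitian_stabilizer (Cd : {vspace 'rV[F]_n}) :
  (herm_dual q Cd <= Cd)%VS ->
  exists P : 'M[C]_#|T|, [/\ P *m P = P, P^t* = P,
    \tr P = (q ^ (2 * \dim Cd - n))%:R &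
    forall u, u \notin Cd -> P *m wmx u *m P = 0].
Proof.
move=> dC; pose D := [set v in herm_dual q Cd].
have q0 : (0 < q)%N := prime_power_gt0 q_pow.
have [] := @stabilizer_projector C #|T| 'rV[F]_n D wmx wmx_cocycle.
- by rewrite card_qbasis expn_gt0 q0.
- by rewrite inE mem0v.
- by move=> u v; rewrite !inE => uD vD; rewrite memvD.
- by move=> u; rewrite !inE => uD; rewrite memvN.
- exact: wmxM.
- exact: wmx0.
- exact: wmx_adj.
- exact: wmx_tr.
- by move=> u; rewrite wmx_cocycleN.
- by move=> u; exact: wmx_cocycle_norm.
- move=> u v; rewrite !inE => /herm_dualP uD /(subvP dC) vC.
  rewrite wmx_cocycle_swap uD //.
  by rewrite (char0 (@wcharD _ _ _ W) (@wchar_norm _ _ _ W)) mul1r.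
move=> P [PP Padj trP detP]; exists P; split=> //.
  have dn := dim_rV_leq Cd.
  (* Containment gives [n <= 2 * \dim Cd], so the exponent of the trace is not truncated. *)
  have dd := dimvS dC; rewrite (dim_herm_dual q_pow card_F) in dd.
  have qX m : (q ^ m)%:R != 0 :> C by rewrite pnatr_eq0 -lt0n expn_gt0 q0.
  rewrite trP card_qbasis card_vspace_rV card_F -expnM (dim_herm_dual q_pow card_F).
  apply: (canLR (mulfK (qX _))); rewrite -natrM -expnD; congr ((q ^ _)%:R).
  lia.
move=> u uC; apply: detP.
have [w wD uw] : exists2 w, w \in herm_dual q Cd & \sum_i u 0 i * w 0 i ^+ q != 0.
  case: (boolP [exists w in herm_dual q Cd, \sum_i u 0 i * w 0 i ^+ q != 0]).
    by case/exists_inP => w wD h; exists w.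
  move/exists_inPn => h; case/negP: uC; rewrite -(herm_dualK q_pow card_F Cd).
  by apply/herm_dualP => w /h; rewrite negbK => /eqP.
have [z z1] := wchar_nontrivial W.
set h := \sum_i _ in uw.
(* The form is [q]-semilinear in its second argument, so this multiple of [w] changes its value from
   [h] to [z], where [wchar] is not 1. *)
exists ((z / h) ^+ q *: w); first by rewrite inE memvZ.
rewrite wmx_cocycle_swap; set s := \sum_i _.
have -> : s = z.
  rewrite -[RHS](mulfVK uw) /s /h mulr_sumr; apply: eq_bigr => i _.
  by rewrite mxE exprMn (frobK card_F) mulrCA.
rewrite -subr_eq0 -{2}[wmx_cocycle _ u]mul1r -mulrBl mulf_neq0 ?subr_eq0 //.
by rewrite -normr_gt0 wmx_cocycle_norm ltr01.
Qed.

End HermitianCode.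

(** * Expansion of local errors in Weyl operators *)

Section LocalErrors.
Variables (C : numClosedFieldType) (q : nat) (o : 'I_q) (I : finType).
Local Notation T := (qbasis q I).

(** Resetting the qudits outside [S] to a reference label lets a function of the labels in [S] be
    written on all of [T], without a subtype. *)
Definition qmask (S : {set I}) (s : T) : T := [ffun i => if i \in S then s i else o].

Definition local_on (S : {set I}) (E : 'M[C]_#|T|) : Prop :=
  exists B : T -> T -> C, forall s t : T,
    entry E s t = B (qmask S s) (qmask S t) * \prod_(i | i \notin S) (s i == t i)%:R.

Variables (F : finFieldType) (W : weyl_system C F q).

(** On each qudit of [S] the Weyl operators span all matrices; on every other qudit the error is the
    identity, which is [wop W 0]. *)
Lemma local_expansion (S : {set I}) (E : 'M[C]_#|T|) : local_on S E ->
  exists a : {ffun I -> F} -> C,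
    (forall v, a v != 0 -> forall i, i \notin S -> v i = 0) /\
    E = \sum_v a v *: tensor_mx (fun k => wop W (v k)).
Proof.
case=> B EB; have q0 : q%:R != 0 :> C.
  by rewrite pnatr_eq0 -lt0n (leq_ltn_trans (leq0n _) (ltn_ord o)).
(* Inside [S] these are the coefficients of the matrix unit at [a i], [b i]. Outside they select
   [x = 0] and admit only labels equal to [o], so each masked pair is counted once. *)
pose c (a b : T) (i : I) (x : F) : C :=
  if i \in S then q%:R^-1 * (wop W x (a i) (b i))^*
  else ((a i == o) && (b i == o) && (x == 0))%:R.
pose m (a b : T) (i : I) (s t : 'I_q) : C := \sum_x c a b i x * wop W x s t.
have mE a b i s t : m a b i s t =
    if i \in S then ((s == a i) && (t == b i))%:R
    else ((a i == o) && (b i == o) && (s == t))%:R.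
  rewrite /m /c; case: ifP => _.
    under eq_bigr => x _ do rewrite -mulrA.
    by rewrite -mulr_sumr wop_complete mulKf // ![a i == _]eq_sym ![b i == _]eq_sym.
  rewrite (bigD1 0) //= big1 => [|x x0]; last by rewrite (negbTE x0) andbF mul0r.
  by rewrite eqxx andbT addr0 wop0 -natrM mulnb.
have prod_m (a b s t : T) : \prod_k m a b k (s k) (t k) =
    ((a == qmask S s) && (b == qmask S t))%:R * \prod_(i | i \notin S) (s i == t i)%:R.
  have [/andP[/eqP-> /eqP->]|ab] := boolP (_ && _).
    rewrite mul1r [RHS]big_mkcond /=; apply: eq_bigr => k _.
    by rewrite mE !ffunE; case: (k \in S); rewrite !eqxx.
  rewrite mul0r.
  have [k hk] : exists k, ~~ ((a k == qmask S s k) && (b k == qmask S t k)).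
    apply/existsP; apply: contraNT ab => /existsPn h; apply/andP.
    by split; apply/eqP/ffunP => k; have := h k; rewrite negbK => /andP[/eqP ? /eqP ?].
  rewrite (bigD1 k) //= mE; move: hk; rewrite !ffunE.
  case: (k \in S) => /negbTE h; last by rewrite h mul0r.
  by rewrite eq_sym [t k == _]eq_sym h mul0r.
have EE : E = \sum_(ab : T * T) B ab.1 ab.2 *: tensor_mx (m ab.1 ab.2).
  apply/matrixP => i j; rewrite summxE.
  have := EB (enum_val i) (enum_val j); rewrite /entry !enum_valK => ->.
  rewrite (bigD1 (qmask S (enum_val i), qmask S (enum_val j))) //= [X in _ + X]big1.
    by rewrite !mxE prod_m !eqxx mul1r addr0.
  move=> [a b]; rewrite xpair_eqE !mxE prod_m => /negbTE ->.
  by rewrite mul0r mulr0.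
exists (fun v => \sum_(ab : T * T) B ab.1 ab.2 * \prod_k c ab.1 ab.2 k (v k)); split.
  move=> v av i iS; apply: contra_neq_eq av => vi; rewrite big1 // => ab _.
  by rewrite (bigD1 i) //= /c (negbTE iS) (negbTE vi) andbF mul0r mulr0.
rewrite EE; under eq_bigr => ab _ do rewrite tensor_mx_sum scaler_sumr.
rewrite exchange_big; apply: eq_bigr => v _; rewrite scaler_suml.
by apply: eq_bigr => ab _; rewrite scalerA.
Qed.

End LocalErrors.

(** In the Weyl expansion of a local error, the zero vector contributes a multiple of [P], and every
    other vector is too light to lie in [Cd], so it contributes nothing. *)
Theorem hermitian_code (C : numClosedFieldType) (F : finFieldType) (q : nat)
  (o : 'I_q) (I : finType) (n k d : nat) (Cd : {vspace 'rV[F]_n}) :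
  (exists p m : nat, [/\ prime p, (0 < m)%N & q = (p ^ m)%N]) ->
  #|F| = (q ^ 2)%N -> #|I| = n -> linear_code Cd k d -> (herm_dual q Cd <= Cd)%VS ->
  exists P : 'M[C]_#|qbasis q I|, [/\ P *m P = P, P^t* = P,
    \tr P = (q ^ (2 * k - n))%:R &
    forall (S : {set I}) E, (#|S| < d)%N -> local_on o S E ->
      exists lambda, P *m E *m P = lambda *: P].
Proof.
move=> q_pow card_F cI [<- [_ Cd_dist]] dC.
have [W] := weyl_system_exists C q_pow card_F.
pose pos (i : I) : 'I_n := cast_ord cI (enum_rank i).
pose pos' (j : 'I_n) : I := enum_val (cast_ord (esym cI) j).
have posK : cancel pos pos' by move=> i; rewrite /pos /pos' cast_ordK enum_rankK.
have posK' : cancel pos' pos by move=> j; rewrite /pos /pos' enum_valK cast_ordKV.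
have pos_bij : bijective pos by exists pos'.
have [P [PP Padj trP Pdet]] := hermitian_stabilizer W q_pow card_F pos_bij dC.
exists P; split=> // S E Sd /(local_expansion W)[a [a_supp ->]].
rewrite mulmx_sumr mulmx_suml.
apply: (big_ind (fun X => exists lambda, X = lambda *: P)).
- by exists 0; rewrite scale0r.
- by move=> X Y [x ->] [y ->]; exists (x + y); rewrite scalerDl.
move=> v _; have [->|av] := eqVneq (a v) 0.
  by exists 0; rewrite !scale0r mulmx0 mul0mx.
pose u : 'rV[F]_n := \row_j v (pos' j).
have -> : tensor_mx (fun k => wop W (v k)) = wmx W pos u.
  by apply: eq_tensor_mx => i s t; rewrite mxE posK.
rewrite -scalemxAr -scalemxAl.
have [u0|u0] := eqVneq u 0.
  by exists (a v); rewrite u0 wmx0 mulmx1 PP.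
exists 0; rewrite Pdet ?scaler0 ?scale0r //; apply: contraTN Sd => uC.
(* The distance from [u] to the codeword 0 is its weight, bounded by the size of [S]. *)
rewrite -leqNgt; apply: (leq_trans (Cd_dist u 0 uC (mem0v _) u0)).
rewrite -(card_imset _ (can_inj posK)); apply: subset_leq_card.
apply/subsetP => j; rewrite inE !mxE => vj.
apply/imsetP; exists (pos' j); rewrite ?posK' //.
by apply: contraNT vj => /(a_supp _ av) ->.
Qed.

(** * Adding entangled pairs *)

Section FiniteHilbert.
Variable C : numClosedFieldType.

Lemma entryM (T : finType) (A B : 'M[C]_#|T|) x y :
  entry (A *m B) x y = \sum_z entry A x z * entry B z y.
Proof. by rewrite /entry mxE big_rank. Qed.

Lemma entry_adj (T : finType) (A : 'M[C]_#|T|) x y :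
  entry (A^t*) x y = (entry A y x)^*.
Proof. by rewrite /entry !mxE. Qed.

Lemma entry1 (T : finType) (x y : T) : entry (1%:M : 'M[C]_#|T|) x y = (x == y)%:R.
Proof. by rewrite /entry mxE (inj_eq enum_rank_inj). Qed.

Lemma entry_inj (T : finType) (A B : 'M[C]_#|T|) :
  (forall x y, entry A x y = entry B x y) -> A = B.
Proof.
move=> AB; apply/matrixP => i j.
by have := AB (enum_val i) (enum_val j); rewrite /entry !enum_valK.
Qed.

Lemma entry_tens (T1 T2 : finType) (A : 'M[C]_#|T1|) (B : 'M[C]_#|T2|) x y :
  entry (tens_op A B) x y = entry A x.1 y.1 * entry B x.2 y.2.
Proof. by rewrite /entry mxE !enum_rankK. Qed.

Lemma tens_opM (T1 T2 : finType) (A A' : 'M[C]_#|T1|) (B B' : 'M[C]_#|T2|) :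
  tens_op A B *m tens_op A' B' = tens_op (A *m A') (B *m B').
Proof.
apply: entry_inj => x y; rewrite entryM entry_tens !entryM big_distrlr /=.
rewrite pair_big /=; apply: eq_bigr => z _; rewrite !entry_tens mulrACA //.
Qed.

Lemma tens_op_adj (T1 T2 : finType) (A : 'M[C]_#|T1|) (B : 'M[C]_#|T2|) :
  (tens_op A B)^t* = tens_op (A^t*) (B^t*).
Proof. by apply: entry_inj => x y; rewrite entry_adj !entry_tens !entry_adj rmorphM. Qed.

End FiniteHilbert.

Section Lift.
Variables (C : numClosedFieldType) (q : nat) (o : 'I_q) (N k c : nat).
Hypothesis o0 : (o : nat) = 0%N.
Local Notation I1 := ('I_k + 'I_(N - k - c))%type.
Local Notation I := (sender N k c).
Local Notation T1 := (qbasis q I1).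
Local Notation Tc := (qbasis q 'I_c).
Local Notation T := (qbasis q I).
Local Notation K := (qbasis q 'I_k).

Definition qjoin (s : T1) (z : Tc) : T :=
  [ffun i => match i with inl a => s a | inr b => z b end].
Definition qleft (s : T) : T1 := [ffun a => s (inl a)].
Definition qright (s : T) : Tc := [ffun b => s (inr b)].
Definition pad0 (x : K) : T1 := [ffun a => if a is inl i then x i else o].

Lemma qleft_join s z : qleft (qjoin s z) = s.
Proof. by apply/ffunP => a; rewrite !ffunE. Qed.
Lemma qright_join s z : qright (qjoin s z) = z.
Proof. by apply/ffunP => a; rewrite !ffunE. Qed.
Lemma qjoinK s : qjoin (qleft s) (qright s) = s.
Proof. by apply/ffunP => -[a|b]; rewrite !ffunE. Qed.

Lemma pad0_inj : injective pad0.
Proof.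
by move=> x y /ffunP xy; apply/ffunP => i; have := xy (inl i); rewrite !ffunE.
Qed.

Lemma big_qjoin (f : T -> C) : \sum_s f s = \sum_(z : Tc) \sum_(s : T1) f (qjoin s z).
Proof.
rewrite pair_big /= (reindex (fun p : Tc * T1 => qjoin p.2 p.1)) //=.
apply: onW_bij; exists (fun s => (qright s, qleft s)) => [[z s]|s] /=.
  by rewrite qleft_join qright_join.
exact: qjoinK.
Qed.

(** [U0] tensored with the identity on the sender's halves. The basis consists of functions on a sum
    type rather than pairs, so [tens_op] does not have the right type. *)
Definition extend_op (U0 : 'M[C]_#|T1|) : 'M[C]_#|T| :=
  \matrix_(i, j) (entry U0 (qleft (enum_val i)) (qleft (enum_val j)) *
                  (qright (enum_val i) == qright (enum_val j))%:R).

Lemma entry_extend U0 s z t z' :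
  entry (extend_op U0) (qjoin s z) (qjoin t z') = entry U0 s t * (z == z')%:R.
Proof. by rewrite /entry mxE !enum_rankK !qleft_join !qright_join. Qed.

(** The diagonal block with the sender's halves in state [z]; the sum of these blocks is the partial
    trace over the halves. *)
Definition slice (M : 'M[C]_#|T|) (z : Tc) : 'M[C]_#|T1| :=
  \matrix_(i, j) entry M (qjoin (enum_val i) z) (qjoin (enum_val j) z).

Lemma entry_slice M z s t : entry (slice M z) s t = entry M (qjoin s z) (qjoin t z).
Proof. by rewrite /entry mxE !enum_rankK. Qed.

Lemma extend_unitary U0 : U0 \is unitarymx -> extend_op U0 \is unitarymx.
Proof.
move=> /unitarymxP UU; apply/unitarymxP; apply: entry_inj => x y.
rewrite -(qjoinK x) -(qjoinK y).
move: (qleft x) (qright x) (qleft y) (qright y) => s z t z'.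
rewrite entryM big_qjoin (bigD1 z) //= [X in _ + X]big1 ?addr0 => [|w wz]; last first.
  by apply: big1 => r _; rewrite entry_extend eq_sym (negbTE wz) mulr0 mul0r.
under eq_bigr => r _.
  rewrite entry_adj !entry_extend eqxx mulr1 rmorphM /= rmorph_nat mulrA.
  rewrite -entry_adj.
  over.
rewrite -mulr_suml -entryM UU !entry1 -natrM mulnb; congr (nat_of_bool _)%:R.
rewrite [z' == z]eq_sym; apply/andP/eqP => [[/eqP-> /eqP->] //|h].
by rewrite -(qleft_join s z) -{2}(qright_join s z) h qleft_join qright_join !eqxx.
Qed.

Lemma slice_conj U0 E z :
  slice ((extend_op U0)^t* *m E *m extend_op U0) z = U0^t* *m slice E z *m U0.
Proof.
apply: entry_inj => s t; rewrite entry_slice !entryM big_qjoin.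
rewrite (bigD1 z) //= [X in _ + X]big1 ?addr0 => [|w wz]; last first.
  by apply: big1 => r _; rewrite entry_extend (negbTE wz) !mulr0.
apply: eq_bigr => r _; rewrite entry_extend eqxx mulr1; congr (_ * _).
rewrite !entryM big_qjoin (bigD1 z) //= [X in _ + X]big1 ?addr0 => [|w wz]; last first.
  by apply: big1 => r' _; rewrite entry_adj entry_extend (negbTE wz) mulr0 conjC0 mul0r.
by apply: eq_bigr => r' _; rewrite !entry_adj entry_extend eqxx mulr1 entry_slice.
Qed.

(** The matrix of the linear map [eainput]: each pair contributes an inverse square root of [q] and
    forces the labels of its two halves to agree. *)
Definition input_mx : 'M[C]_(#|{: T * Tc}|, #|K|) :=
  \matrix_(i, j) ((sqrtC q%:R)^-1 ^+ c *
    ((enum_val i).1 == qjoin (pad0 (enum_val j)) (enum_val i).2)%:R).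

Lemma prod_nat_bool (J : finType) (b : pred J) :
  \prod_j (b j)%:R = [forall j, b j]%:R :> C.
Proof.
have [/forallP h|] := boolP [forall j, b j]; first by rewrite big1 // => j _; rewrite h.
by rewrite negb_forall => /existsP[j /negbTE bj]; rewrite (bigD1 j) //= bj mul0r.
Qed.

Lemma input_mxE (psi : 'cV[C]_#|K|) : eainput N c psi = input_mx *m psi.
Proof.
apply/colP => i; rewrite !mxE.
pose x0 : K := [ffun a => (enum_val i).1 (inl (inl a))].
have -> : \prod_j phi_amp C ((enum_val i).1 (inr j)) ((enum_val i).2 j) =
    (sqrtC q%:R)^-1 ^+ c * [forall j, (enum_val i).1 (inr j) == (enum_val i).2 j]%:R.
  by rewrite big_split /= prodr_const card_ord prod_nat_bool.
rewrite prod_nat_bool (bigD1 (enum_rank x0)) //=.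
rewrite [X in _ + X]big1 => [|j jx0]; last first.
  rewrite !mxE; case: eqP => [xE|_]; last by rewrite mulr0 mul0r.
  case/eqP: jx0; apply: (canRL enum_valK); apply/ffunP => a.
  by rewrite ffunE xE !ffunE.
rewrite addr0 !mxE enum_rankK -/x0.
have -> : ((enum_val i).1 == qjoin (pad0 x0) (enum_val i).2) =
    [forall j, ((enum_val i).1 (inl (inr j)) : nat) == 0%N] &&
    [forall j, (enum_val i).1 (inr j) == (enum_val i).2 j].
  apply/eqP/andP => [xE|[/forallP anc0 /forallP ebits]].
    by split; apply/forallP => j; apply/eqP; rewrite xE !ffunE.
  apply/ffunP => -[[a|a]|b]; rewrite !ffunE //; last exact/eqP.
  by apply: val_inj; rewrite /= o0; apply/eqP.
rewrite -mulnb natrM /amp; ring.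
Qed.

(** The identity on the receiver's halves forces equal labels on both sides, so maximally entangled
    pairs average [M] over its diagonal blocks. *)
Lemma input_gram (M : 'M[C]_#|T|) (x y : K) :
  (input_mx^t* *m tens_op M 1%:M *m input_mx) (enum_rank x) (enum_rank y) =
  q%:R^-1 ^+ c * \sum_z entry (slice M z) (pad0 x) (pad0 y).
Proof.
have sum_col (f : T * Tc -> C) w :
    \sum_p f p * input_mx (enum_rank p) (enum_rank w) =
    (sqrtC q%:R)^-1 ^+ c * \sum_z f (qjoin (pad0 w) z, z).
  transitivity (\sum_s \sum_z f (s, z) * ((sqrtC q%:R)^-1 ^+ c *
      (s == qjoin (pad0 w) z)%:R)).
    by rewrite pair_big /=; apply: eq_bigr => -[s z] _; rewrite mxE !enum_rankK.
  rewrite exchange_big mulr_sumr.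
  apply: eq_bigr => z _; rewrite (bigD1 (qjoin (pad0 w) z)) //= big1 => [|s /negbTE ->].
    by rewrite eqxx mulr1 addr0 mulrC.
  by rewrite !mulr0.
rewrite mxE big_rank sum_col.
have kap : (sqrtC q%:R)^-1 ^+ c * ((sqrtC q%:R)^-1 ^+ c)^* = q%:R^-1 ^+ c :> C.
  rewrite -normCK normrX -exprM mulnC exprM normfV; congr (_ ^+ c).
  by rewrite exprVn -normrX sqrtCK normr_nat.
rewrite -kap -mulrA; congr (_ * _); rewrite mulr_sumr; apply: eq_bigr => z _.
pose f p := (entry (tens_op M 1%:M) p (qjoin (pad0 y) z, z))^*.
transitivity ((\sum_p f p * input_mx (enum_rank p) (enum_rank x))^*).
  rewrite rmorph_sum mxE big_rank; apply: eq_bigr => p _.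
  by rewrite rmorphM /= conjCK mulrC; congr (_ * _); rewrite !mxE.
rewrite sum_col rmorphM /=; congr (_ * _).
rewrite rmorph_sum (bigD1 z) //= big1 => [|w wz].
  by rewrite conjCK entry_tens /= entry1 eqxx mulr1 entry_slice addr0.
by rewrite conjCK entry_tens /= entry1 (negbTE wz) mulr0.
Qed.

(** With the halves fixed at [z] on both sides, their identity factors are 1, and only the part of
    [S] among data qudits and ancillas remains. *)
Lemma supported_slice (S : {set I}) (E : 'M[C]_#|T|) z : supported_on S E ->
  local_on o [set a | inl a \in S] (slice E z).
Proof.
case=> A EA; pose S1 : {set I1} := [set a | inl a \in S].
exists (fun s t => entry A (qrestr S (qjoin s z)) (qrestr S (qjoin t z))) => s t.
have restr_mask r : qrestr S (qjoin (qmask o S1 r) z) = qrestr S (qjoin r z).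
  by apply/ffunP => -[[a|b] iS]; rewrite !ffunE //= ffunE inE iS.
rewrite entry_slice EA !restr_mask; congr (_ * _); rewrite big_sumType /=.
rewrite [X in _ * X]big1 ?mulr1 => [|b _]; last by rewrite !ffunE eqxx.
by apply: eq_big => [a|a _]; rewrite ?inE // !ffunE.
Qed.

Lemma tens_op11 (A B : finType) : tens_op (1%:M : 'M[C]_#|A|) (1%:M : 'M[C]_#|B|) = 1%:M.
Proof.
by apply: entry_inj => -[x y] [x' y']; rewrite entry_tens !entry1 -natrM mulnb.
Qed.

(** The encoder acts on data and ancillas through a unitary diagonalizing [P0] and leaves the halves
    alone. An error then compresses to an average of slices, each scalar by the property of [P0]. *)
Lemma eaqecc_of_projector d (P0 : 'M[C]_#|T1|) :
  (k + c <= N)%N -> P0 *m P0 = P0 -> P0^t* = P0 -> \tr P0 = (q ^ k)%:R ->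
  (forall (S : {set I1}) E, (#|S| < d)%N -> local_on o S E ->
      exists lambda, P0 *m E *m P0 = lambda *: P0) ->
  exists Q : {vspace 'cV[C]_#|{: T * Tc}|}, is_eaqecc d Q.
Proof.
move=> kcN P0P0 P0adj trP0 detP0.
(* These are the basis states with all ancillas zero; [U0] will map their span onto the range of
   [P0]. *)
pose A := [set enum_rank (pad0 x) | x : K].
have inA x : enum_rank (pad0 x) \in A by apply/imsetP; exists x.
have cardA : #|A| = (q ^ k)%N.
  by rewrite card_imset ?card_ffun ?card_ord // => x y /enum_rank_inj /pad0_inj.
have [U0 U0u P0E] : exists2 U, U \is unitarymx & P0 = U *m diag_set C A *m U^t*.
  by apply: projector_diag; rewrite ?cardA.
have U0tU0 : U0^t* *m U0 = 1%:M.
  by rewrite -(invmx_unitary U0u) mulVmx ?unitarymx_unit.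
pose U := extend_op U0.
have Uu : U \is unitarymx := extend_unitary U0u.
have UtU : U^t* *m U = 1%:M.
  by rewrite -(invmx_unitary Uu) mulVmx ?unitarymx_unit.
(* [V] is the encoding isometry: its range is the code and [V *m V^t*] the projector. *)
pose V := tens_op U 1%:M *m input_mx.
have VE (E : 'M[C]_#|T|) : V^t* *m tens_op E 1%:M *m V =
    input_mx^t* *m tens_op (U^t* *m E *m U) 1%:M *m input_mx.
  rewrite adjmxM tens_op_adj !mulmxA -(mulmxA _ _ (tens_op E _)) tens_opM.
  rewrite -(mulmxA _ _ (tens_op U _)) tens_opM mulmx1.
  by congr (_ *m tens_op _ _ *m _); apply/eqP; rewrite trmx1 map_mx1 mulmx1.
have VtV : V^t* *m V = 1%:M.
  have := VE 1%:M; rewrite tens_op11 !mulmx1 UtU => ->.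
  apply: entry_inj => x y; rewrite [LHS]input_gram entry1.
  under eq_bigr => z _.
    rewrite entry_slice entry1.
    have -> : (qjoin (pad0 x) z == qjoin (pad0 y) z) = (x == y).
      apply/eqP/eqP => [h|-> //]; apply: pad0_inj.
      by rewrite -(qleft_join (pad0 x) z) h qleft_join.
    over.
  rewrite sumr_const card_ffun !card_ord -[X in _ * X]mulr_natl natrX mulrA.
  rewrite -exprMn mulVf ?expr1n ?mul1r //.
  by rewrite pnatr_eq0 -lt0n (leq_ltn_trans (leq0n _) (ltn_ord o)).
(* Conjugation by [U0] turns [P0] into [diag_set C A], so the entries indexed by [A] can be read
   off. *)
have KL (E0 : 'M[C]_#|T1|) lambda : P0 *m E0 *m P0 = lambda *: P0 -> forall x y,
    entry (U0^t* *m E0 *m U0) (pad0 x) (pad0 y) = lambda * (x == y)%:R.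
  move=> h x y.
  have : U0^t* *m (P0 *m E0 *m P0) *m U0 = U0^t* *m (lambda *: P0) *m U0 by rewrite h.
  rewrite -scalemxAr -scalemxAl P0E !mulmxA U0tU0 mul1mx.
  rewrite -(mulmxA _ (U0^t*) U0) U0tU0 mulmx1.
  rewrite -(mulmxA _ (U0^t*) U0) U0tU0 mulmx1.
  move=> /matrixP /(_ (enum_rank (pad0 x)) (enum_rank (pad0 y))).
  rewrite /diag_set mul_mx_diag -!mulmxA mul_diag_mx [LHS]mxE [X in X * _]mxE.
  rewrite mulmxA !(mxE _ (fun _ _ => (_ \in A)%:R)) !inA.
  rewrite mul1r mulr1 /entry => ->.
  by rewrite !mxE inA (inj_eq enum_rank_inj) (inj_eq pad0_inj).
have QE v : reflect (exists psi, v = V *m psi)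
    (v \in limg (linfun (mulmx V : 'cV__ -> 'cV__))).
  apply: (iffP memv_imgP) => [[psi _ ->]|[psi ->]]; first by exists psi; rewrite lfunE.
  by exists psi; rewrite ?memvf // lfunE.
exists (limg (linfun (mulmx V : 'cV__ -> 'cV__))); split=> //.
  exists U => // v; split=> [/QE[psi ->]|[psi ->]].
    by exists psi; rewrite input_mxE mulmxA.
  by apply/QE; exists psi; rewrite input_mxE mulmxA.
exists (V *m V^t*).
  split; first by rewrite mulmxA -(mulmxA V) VtV mulmx1.
    by rewrite adjmxM trmxCK.
  move=> v; split=> [/QE[psi ->]|[w ->]].
    by exists (V *m psi); rewrite mulmxA -(mulmxA V) VtV mulmx1.
  by apply/QE; exists (V^t* *m w); rewrite mulmxA.
move=> S E Sd suppE.
suff [lambda h] : exists lambda : C, V^t* *m tens_op E 1%:M *m V = lambda%:M.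
  exists lambda; transitivity (V *m (V^t* *m tens_op E 1%:M *m V) *m V^t*).
    by rewrite !mulmxA.
  by rewrite h scalar_mxC mul_scalar_mx -scalemxAl.
have S1d : (#|[set a : I1 | inl a \in S]| < d)%N.
  apply: leq_ltn_trans Sd; rewrite -(card_imset _ (@inl_inj I1 'I_c)).
  by apply: subset_leq_card; apply/subsetP => _ /imsetP[a + ->]; rewrite inE.
have [f fE] : exists f : Tc -> C, forall z, P0 *m slice E z *m P0 = f z *: P0.
  apply: (@fin_all_exists Tc (fun=> C) (fun z a => P0 *m slice E z *m P0 = a *: P0)) => z.
  exact: (detP0 _ _ S1d (supported_slice z suppE)).
(* This is the average of the scalars [f z] over the [q ^ c] labels of the halves. *)
exists (q%:R^-1 ^+ c * \sum_z f z); rewrite VE.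
apply: entry_inj => x y; rewrite [LHS]input_gram /U.
under eq_bigr => z _ do rewrite slice_conj (KL _ _ (fE z)).
by rewrite -mulr_suml mulrA /entry mxE (inj_eq enum_rank_inj) mulr_natr.
Qed.

End Lift.

Local Open Scope complex_scope.

Theorem proposition4p5 (R : realType) (q : nat)
  (q_prime_power : exists p m : nat, [/\ prime p, (0 < m)%N & q = (p ^ m)%N])
  (q_gt2 : (2 < q)%N)
  (F : finFieldType) (card_F : #|F| = (q ^ 2)%N)
  (n k d l : nat) (C : {vspace 'rV[F]_n})
  (C_code : linear_code C k d)
  (C_dual_containing : (herm_dual q C <= C)%VS)
  (C_codim : (\dim C - \dim (herm_dual q C))%N = l)
  (c : nat) (c_le_l : (c <= l)%N) :
  exists (d' : nat)
    (Q : {vspace 'cV[R[i]]_#|{: qbasis q (sender (n + c) (2 * k - n) c) *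
                                qbasis q 'I_c}|}),
    [/\ is_eaqecc d' Q, (d <= d')%N & (d' <= d + c)%N].
Proof.
have q0 : (0 < q)%N := prime_power_gt0 q_prime_power.
have kn : (k <= n)%N by case: C_code => <- _; exact: dim_rV_leq.
pose o := Ordinal q0.
(* Since [k <= n], data qudits and ancillas together number [n], the length of [C]; the [c] halves
   come in addition. *)
have cI : #|{: 'I_(2 * k - n) + 'I_(n + c - (2 * k - n) - c)}| = n.
  by rewrite card_sum !card_ord; lia.
have [P [PP Padj trP Pdet]] :=
  hermitian_code R[i] o q_prime_power card_F cI C_code C_dual_containing.
have kcN : (2 * k - n + c <= n + c)%N by lia.
have [Q QP] := @eaqecc_of_projector R[i] q o _ _ c erefl d P kcN PP Padj trP Pdet.
by exists d, Q; split; rewrite ?leq_addr.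
Qed.
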